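(* Assume Markov's principle. Then $\mathbb{N}_\infty$ has the $\bigcirc_{\mathsf{LPO}}$ strong Myhill property: for every pair of injections $f, g : \mathbb{N}_\infty \to \mathbb{N}_\infty$ there is a bijection $h : \mathbb{N}_\infty \to \mathbb{N}_\infty$ such that, for every $x \in \mathbb{N}_\infty$, $\bigcirc_{\mathsf{LPO}}\left(\exists m \in \mathbb{Z}.\ (x,h(x)) \in R^{f,g}_m\right)$ holds.
   Context: The statement is to be proved constructively (intuitionistic set theory with powersets and $\mathbb{N}$, equivalently the internal logic of a topos with natural numbers object; neither excluded middle nor choice is assumed). $\mathbb{N}_\infty \subseteq 2^{\mathbb{N}}$ is the set of bit sequences containing at most one $1$. For $n \in \mathbb{N}$, $\underline{n} = 0^n 1 0^\omega \in \mathbb{N}_\infty$; $\underline{\mathbb{N}} = \{\underline{n} \mid n \in \mathbb{N}\}$; $\infty = 0^\omega$. Markov's principle: for every $p \in 2^{\mathbb{N}}$, if $p \neq 0^\omega$, then there exists $n \in \mathbb{N}$ with $p_n = 1$. For a proposition $p$, $\bigcirc_{\mathsf{LPO}}\, p$ is the proposition $\exists w \in \mathbb{N}_\infty.\ \big((w \in \underline{\mathbb{N}} \vee w = \infty) \Rightarrow p\big)$. For injections $f, g : X \to X$ and $m \in \mathbb{Z}$, $R^{f,g}_m \subseteq X \times X$ denotes the (graph of the) partial injection written $f \circ (g \circ f)^m$: for $m \ge 0$, $(x,y) \in R^{f,g}_m$ iff $y = f((g\circ f)^m(x))$; for $m < 0$, $(x,y) \in R^{f,g}_m$ iff $x = g((f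 \circ g)^{-m-1}(y))$. *)

(* Defs.v *)
(** MathComp.  Propositions are [Prop], whose logic is intuitionistic: no
    axiom is assumed here.  Equality of bit sequences is Leibniz equality,
    which is equality of sets under functional extensionality. *)
From mathcomp Require Import all_boot ssrint.

Set Implicit Arguments.
Unset Strict Implicit.
Unset Printing Implicit Defensive.

Definition at_most_one (p : nat -> bool) : Prop :=
  forall i j, p i = true -> p j = true -> i = j.

Record Ninf : Type := MkNinf { bits : nat -> bool; bitsP : at_most_one bits }.

Lemma underline_subproof (n : nat) : at_most_one (fun i => i == n).
Proof. by move=> i j /eqP -> /eqP ->. Qed.

(** The sequence [0^n 1 0^omega]. *)
Definition underline (n : nat) : Ninf := MkNinf (@underline_subproof n).

Lemma infty_subproof : at_most_one (fun=> false).
Proof. by []. Qed.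

Definition infty : Ninf := MkNinf infty_subproof.

Definition Markov : Prop :=
  forall p : nat -> bool, p <> (fun=> false) -> exists n, p n = true.

Definition O_LPO (p : Prop) : Prop :=
  exists w : Ninf, ((exists n, w = underline n) \/ w = infty) -> p.

(** The graph of [f \o (g \o f)^m].  As [Negz n] is the integer [- (n + 1)],
    the exponent [- m - 1] for [m = Negz n] is [n]. *)
Definition R (X : Type) (f g : X -> X) (m : int) (x y : X) : Prop :=
  match m with
  | Posz n => y = f (iter n (g \o f) x)
  | Negz n => x = g (iter n (f \o g) y)
  end.

Definition strong_Myhill (O : Prop -> Prop) (X : Type) : Prop :=
  forall f g : X -> X, injective f -> injective g ->
  exists h : X -> X,
    bijective h /\ forall x : X, O (exists m : int, R f g m x (h x)).

(* Main.v *)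
(** Constructively, and using only function extensionality: let [w] be the first
    position where a [1] occurs in [f infty] or [g infty].  If [w] is finite,
    then equality with [infty] is decidable, since for instance
    [f infty = underline k] gives [x = infty] iff the [k]-th bit of [f x] is [1];
    by Markov's principle every point is then finite or [infty].  So let [A]
    consist of the finite points, together with [infty] provided that [w] is
    finite.  It is enumerable with decidable equality, and [f], [g] map it to
    itself: either [w] is finite, or [f infty = infty] and Markov's principle
    makes [f x] finite for finite [x]; the bit that separates [f x] from
    [f infty] tells which.  Myhill's back-and-forth construction gives a
    bijection [H] of [A], which extends to all points by letting the [k]-th bit
    of [h x] be [1] iff [x = H^-1 (underline k)].  If [w] is infinite then [h]
    fixes [infty], and so does [f].  Hence deciding whether the first [1] of
    [x] or [w] exists is all that is needed to locate [h x] in the chain of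
    [x]. *)
Require Import Defs.
From Stdlib Require Import FunctionalExtensionality.
From mathcomp Require Import all_boot ssrint.

Set Implicit Arguments.
Unset Strict Implicit.
Unset Printing Implicit Defensive.

(** * Orbits and chains of two injections *)

Section Chains.

Variables (T : Type) (F G : T -> T).
Hypotheses (Finj : injective F) (Ginj : injective G).

Definition same_orbit (x y : T) : Prop :=
  exists n, y = iter n (G \o F) x \/ x = iter n (G \o F) y.

Definition same_chain (x y : T) : Prop := exists m : int, R F G m x y.

Lemma same_orbit_sym x y : same_orbit x y -> same_orbit y x.
Proof. by case=> n [] ->; exists n; [right | left]. Qed.

Lemma iter_inj (n : nat) : injective (iter n (G \o F)).
Proof. by elim: n => [|n IHn] x y //= /Ginj /Finj /IHn. Qed.

(** If [x] and [z] both lead forward to [y], injectivity cancels the common iterates. *)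
Lemma same_orbit_trans y x z : same_orbit x y -> same_orbit y z -> same_orbit x z.
Proof.
case=> i [] xy [j] [] yz.
- by exists (j + i); left; rewrite yz xy iterD.
- rewrite {}xy in yz; case: (leqP i j) => ij.
    exists (j - i); right; apply: (@iter_inj i).
    by rewrite -iterD subnKC.
  exists (i - j); left; apply: (@iter_inj j).
  by rewrite -iterD subnKC 1?ltnW.
- rewrite {}xy {}yz; case: (leqP i j) => ij.
    by exists (j - i); left; rewrite -iterD subnK.
  by exists (i - j); right; rewrite -iterD subnK 1?ltnW.
- by exists (i + j); right; rewrite xy yz iterD.
Qed.

Lemma iter_comp_shift n x : iter n (G \o F) (G x) = G (iter n (F \o G) x).
Proof. by elim: n => //= n ->. Qed.

(** Applying [G] turns exponent [m] into [m + 1], now of [G \o F] alone, so chains can be composed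
    as orbits. *)
Lemma same_chainE x y : same_chain x y <-> same_orbit x (G y).
Proof.
split=> [[[] n /= ->] | [[|n] []]].
- by exists n.+1; left.
- by exists n; right; rewrite iter_comp_shift.
- by move=> /= <-; exists (Negz 0).
- by move=> /= ->; exists (Negz 0).
- by move=> /Ginj ->; exists (Posz n).
- by rewrite iter_comp_shift => ->; exists (Negz n.+1).
Qed.

End Chains.

Lemma same_chain_sym (T : Type) (F G : T -> T) x y :
  same_chain F G x y -> same_chain G F y x.
Proof. by case=> [[] n Rxy]; [exists (Negz n) | exists (Posz n)]. Qed.

(** * Finite matchings along chains *)

Section Matchings.

Variables (T : countType) (F G : T -> T).
Hypotheses (Finj : injective F) (Ginj : injective G).

Definition matching (M : seq (T * T)) : Prop :=
  [/\ uniq (unzip1 M), uniq (unzip2 M) &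
      forall p, p \in M -> same_chain F G p.1 p.2].

(* Follow [a], [F a], its partner [a'], [F a'], and so on.  The witness [c] is
   the last left element of this path: by injectivity of [F], keeping it away
   from the earlier left elements keeps [F c] away from the earlier right ones. *)
Lemma unmatched_image M a : matching M -> a \notin unzip1 M ->
  exists c, [/\ c \in a :: unzip1 M, F c \notin unzip2 M & same_orbit F G a c].
Proof.
have [n] := ubnP (size M); elim: n M a => // n IHn M a leMn [M1 M2 MC] aM.
have [/mapP[[a' b] pM /= Fab] | FaM] := boolP (F a \in unzip2 M); last first.
  by exists a; split; rewrite ?mem_head //; exists 0; left.
have perM := perm_to_rem pM; set M' := rem _ M in perM.
have: uniq (unzip1 ((a', b) :: M')) by rewrite -(perm_uniq (perm_map _ perM)).
have: uniq (unzip2 ((a', b) :: M')) by rewrite -(perm_uniq (perm_map _ perM)).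
move=> /= /andP[bM' M'2] /andP[a'M' M'1].
have mem1 : unzip1 M =i a' :: unzip1 M' by apply/perm_mem/(perm_map fst perM).
have mem2 : unzip2 M =i b :: unzip2 M' by apply/perm_mem/(perm_map snd perM).
case: (IHn M' a') => //.
- by rewrite -ltnS (leq_trans _ leMn) // ltnS (perm_size perM).
- by split=> // p pM'; apply: MC; rewrite (perm_mem perM) inE pM' orbT.
move=> c [cM' FcM' a'c]; rewrite -mem1 in cM'.
exists c; split; first by rewrite inE cM' orbT.
  rewrite mem2 inE negb_or FcM' andbT -Fab (inj_eq Finj).
  by apply: contra aM => /eqP <-.
(* [a] leads to [G (F a) = G b], and [G b] lies in the orbit of [a']. *)
have /same_chainE/= a'b := MC _ pM.
apply: (same_orbit_trans Finj Ginj) a'c.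
apply: (@same_orbit_trans _ _ _ Finj Ginj (G b)).
  by exists 1; left; rewrite -Fab.
exact/same_orbit_sym/a'b.
Qed.

Lemma matching_extend1 M a : matching M ->
  {M' | [/\ matching M', {subset M <= M'} & a \in unzip1 M']}.
Proof.
move=> MM; have [aM | aM] := boolP (a \in unzip1 M); first by exists M; split.
(* [ok] is decidable on a countable type, so [xchoose] turns mere existence of a partner into
   data. *)
pose ok (p : T * int) := (p.1 \notin unzip2 M) &&
  match p.2 with
  | Posz n => p.1 == F (iter n (G \o F) a)
  | Negz n => a == G (iter n (F \o G) p.1)
  end.
have ex_ok : exists p, ok p.
  have [c [_ FcM ac]] := unmatched_image MM aM.
  have /same_chainE [//|m Rm] : same_orbit F G a (G (F c)).
    apply: (same_orbit_trans Finj Ginj) ac _.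
    by exists 1; left.
  by exists (F c, m); rewrite /ok FcM; case: m Rm => n /= ?; apply/eqP.
have /andP[bM Rb] := xchooseP ex_ok; move: (xchoose ex_ok) bM Rb => [b m] /= bM Rb.
exists ((a, b) :: M); split=> [|p pM|]; last by rewrite mem_head.
- case: MM => M1 M2 MC; split; rewrite /= ?aM ?bM // => p.
  rewrite inE => /orP[/eqP -> |/MC//]; exists m.
  by case: m Rb => n /eqP.
- by rewrite inE pM orbT.
Qed.

End Matchings.

(** * Back-and-forth on a countable type *)

Definition swap (T : Type) (p : T * T) := (p.2, p.1).

Section Myhill.

Variables (T : countType) (F G : T -> T).
Hypotheses (Finj : injective F) (Ginj : injective G).

Lemma unzip1_swap (M : seq (T * T)) : unzip1 (map (@swap T) M) = unzip2 M.
Proof. by rewrite /unzip1 -map_comp. Qed.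

Lemma unzip2_swap (M : seq (T * T)) : unzip2 (map (@swap T) M) = unzip1 M.
Proof. by rewrite /unzip2 -map_comp. Qed.

Lemma swap_swap (M : seq (T * T)) : map (@swap T) (map (@swap T) M) = M.
Proof. by rewrite -map_comp map_id_in // => -[]. Qed.

Lemma matching_swap (F' G' : T -> T) M :
  matching F' G' M -> matching G' F' (map (@swap T) M).
Proof.
case=> M1 M2 MC; split; rewrite ?unzip1_swap ?unzip2_swap //.
by move=> _ /mapP[p pM ->]; apply/same_chain_sym/MC.
Qed.

(** The back step is the forth step for [G] and [F] on the swapped matching. *)
Lemma matching_extend M a : matching F G M ->
  {M' | [/\ matching F G M', {subset M <= M'},
            a \in unzip1 M' & a \in unzip2 M']}.
Proof.
move=> /(matching_extend1 Finj Ginj a)[M1 [MM1 sM1 aM1]].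
have [M2 [MM2 sM2 aM2]] := matching_extend1 Ginj Finj a (matching_swap MM1).
exists (map (@swap T) M2).
have sM12 : {subset M1 <= map (@swap T) M2}.
  move=> p pM1; rewrite -(swap_swap M1) in pM1.
  by case/mapP: pM1 => q /sM2 qM ->; apply: map_f.
split.
- exact: matching_swap.
- by move=> p /sM1/sM12.
- by case/mapP: aM1 => p /sM12 pM ->; apply: map_f.
- by rewrite unzip2_swap.
Qed.

Lemma matching0 : matching F G [::].
Proof. by []. Qed.

Fixpoint stage (n : nat) : {M | matching F G M} :=
  if n isn't n'.+1 then exist _ [::] matching0 else
  if unpickle n' isn't Some a then stage n' else
  let M := matching_extend a (svalP (stage n')) in
  exist _ (sval M) (let: And4 MM _ _ _ := svalP M in MM).

Lemma stageS n a : unpickle n = Some a ->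
  {subset sval (stage n) <= sval (stage n.+1)} /\
  (a \in unzip1 (sval (stage n.+1))) && (a \in unzip2 (sval (stage n.+1))).
Proof. by move=> /= ->; case: matching_extend => M [] /= _ ? -> ->. Qed.

Lemma stage_homo m n : m <= n -> {subset sval (stage m) <= sval (stage n)}.
Proof.
elim: n => [|n IHn]; first by case: m.
rewrite leq_eqVlt => /orP[/eqP-> //|/IHn mn p /mn pn].
case En: (unpickle n) => [a|]; first by case: (stageS En) => /(_ _ pn).
by rewrite /= En.
Qed.

(** Stage and partner are paired to give a countable search with a decidable test. *)
Lemma stage_total1 a : exists q : nat * T, (a, q.2) \in sval (stage q.1).
Proof.
have [_ /andP[/mapP[[a' b] pM /= aE] _]] := stageS (pickleK a).
by exists ((pickle a).+1, b); rewrite -aE in pM.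
Qed.

Lemma stage_total2 b : exists q : nat * T, (q.2, b) \in sval (stage q.1).
Proof.
have [_ /andP[_ /mapP[[a b'] pM /= bE]]] := stageS (pickleK b).
by exists ((pickle b).+1, a); rewrite -bE in pM.
Qed.

Lemma uniq_map_inj (S U : eqType) (k : S -> U) (s : seq S) :
  uniq (map k s) -> {in s &, injective k}.
Proof.
move=> us x y xs ys kxy; have x0 := x.
rewrite -(nth_index x0 xs) -(nth_index x0 ys); congr nth; apply/eqP.
rewrite -(nth_uniq (k x0) _ _ us) ?size_map ?index_mem //.
by rewrite !(nth_map x0) ?index_mem // !nth_index // kxy.
Qed.

(** Both pairs lie in the later stage, so a partner does not depend on the stage where it is
    found. *)
Lemma stage_inj m n p q : p \in sval (stage m) -> q \in sval (stage n) ->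
  (p.1 = q.1 -> p = q) /\ (p.2 = q.2 -> p = q).
Proof.
move=> /(stage_homo (leq_maxl m n)) pM /(stage_homo (leq_maxr m n)) qM.
have [M1 M2 _] := svalP (stage (maxn m n)).
by split; [apply: (uniq_map_inj M1) | apply: (uniq_map_inj M2)].
Qed.

Theorem Myhill_countType : exists H H' : T -> T,
  [/\ cancel H H', cancel H' H & forall a, same_chain F G a (H a)].
Proof.
exists (fun a => (xchoose (stage_total1 a)).2).
exists (fun b => (xchoose (stage_total2 b)).2).
split=> a.
- have aM := xchooseP (stage_total1 a); move: (xchoose _) aM => [m b] /= aM.
  have bM := xchooseP (stage_total2 b); move: (xchoose _) bM => [n a'] /= bM.
  by have [_ /(_ erefl) []] := stage_inj bM aM.
- have aM := xchooseP (stage_total2 a); move: (xchoose _) aM => [m b] /= aM.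
  have bM := xchooseP (stage_total1 b); move: (xchoose _) bM => [n a'] /= bM.
  by have [/(_ erefl) []] := stage_inj bM aM.
- have aM := xchooseP (stage_total1 a).
  by have [_ _ /(_ _ aM)] := svalP (stage (xchoose (stage_total1 a)).1).
Qed.

End Myhill.

(** * Equality, finite points and first occurrences in [Ninf] *)

Lemma Ninf_eq (x y : Ninf) : bits x =1 bits y -> x = y.
Proof.
case: x y => [p pP] [q qP] /= /functional_extensionality pq.
case: q / pq qP => qP; congr MkNinf.
(* Below its four binders [at_most_one] is an equality in [nat], whose proofs are all equal. *)
do 4!apply: functional_extensionality_dep => ?.
exact: eq_irrelevance.
Qed.

Lemma bits_underline (x : Ninf) n : bits x n -> x = underline n.
Proof.
move=> xn; apply: Ninf_eq => k /=.
apply/idP/eqP => [xk | -> //]; exact: bitsP xk xn.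
Qed.

Lemma Ninf_eqP (x y : Ninf) : (forall k, bits x k <-> bits y k) -> x = y.
Proof. by move=> xy; apply: Ninf_eq => k; apply/idP/idP => /xy. Qed.

Lemma Ninf_eq_stable (x y : Ninf) : ~ ~ x = y -> x = y.
Proof.
move=> nnxy; apply: Ninf_eq => k; apply/eqP/negPn/negP => /eqP xyk.
by apply: nnxy => xy; rewrite xy in xyk.
Qed.

Lemma underline_inj : injective underline.
Proof. by move=> i j /(congr1 (bits^~ i)) /=; rewrite eqxx => /esym/eqP. Qed.

Lemma first_subproof (p : nat -> bool) :
  at_most_one (fun k => p k && ~~ has p (iota 0 k)).
Proof.
move=> i j /andP[pi /hasPn ni] /andP[pj /hasPn nj].
case: (ltngtP i j) => // ij.
  by move: (nj i); rewrite mem_iota pi ij => /(_ isT).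
by move: (ni j); rewrite mem_iota pj ij => /(_ isT).
Qed.

Definition first (p : nat -> bool) : Ninf := MkNinf (@first_subproof p).

Lemma first_bits p k : bits (first p) k -> p k.
Proof. by case/andP. Qed.

Lemma first_ex (p : nat -> bool) k : p k -> exists j, bits (first p) j.
Proof.
move=> pk; have exp : exists k, p k by exists k.
case: (ex_minnP exp) => j pj minj; exists j; rewrite /= pj /=.
apply/hasPn => i; rewrite mem_iota add0n /= => ij.
by apply: contraL ij => /minj; rewrite -leqNgt.
Qed.

Lemma first_infty p k : first p = infty -> p k = false.
Proof.
by move=> p_oo; apply/negP => /first_ex [j]; rewrite p_oo.
Qed.

Lemma Markov_apart (MP : Markov) (x y : Ninf) :
  x <> y -> exists k, bits x k != bits y k.
Proof.
move=> xy; apply: MP => xy0; apply/xy/Ninf_eq => k.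
by apply/eqP/negbFE; rewrite -[LHS]/((fun k => bits x k != bits y k) k) xy0.
Qed.

Lemma Markov_finite (MP : Markov) (x : Ninf) : x <> infty -> exists k, bits x k.
Proof. by move=> /(Markov_apart MP) [k]; case xk: (bits x k) => // _; exists k. Qed.

(** * The discrete part of [Ninf] and the extension of its bijections *)

Section Finite.

Variables (MP : Markov) (f g : Ninf -> Ninf).
Hypotheses (f_inj : injective f) (g_inj : injective g).

Definition finite_image : Ninf := first (fun k => bits (f infty) k || bits (g infty) k).

(* The discrete part of [Ninf]: the finite elements, together with [infty] as
   soon as [f infty] or [g infty] is known to be finite. *)
Definition code : countType := (nat + {k | bits finite_image k})%type.

Definition decode (a : code) : Ninf := if a is inl n then underline n else infty.

Lemma underline_infty n : underline n <> infty.
Proof. by move=> /(congr1 (bits^~ n)) /=; rewrite eqxx. Qed.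

Lemma decode_inj : injective decode.
Proof.
move=> [i|[i wi]] [j|[j wj]] /=.
- by move/underline_inj->.
- by move/underline_infty.
- by move/esym/underline_infty.
- by move=> _; congr inr; apply: val_inj; apply: bitsP wi wj.
Qed.

Lemma infty_dec (k : Ninf -> Ninf) n (x : Ninf) :
  injective k -> bits (k infty) n -> {x = infty} + {x <> infty}.
Proof.
move=> k_inj /bits_underline kn; case xn: (bits (k x) n); [left | right].
  by apply: k_inj; rewrite kn; apply: bits_underline.
by move=> x_oo; rewrite x_oo kn /= eqxx in xn.
Qed.

Lemma encode (w : {k | bits finite_image k}) (x : Ninf) : {a | decode a = x}.
Proof.
have [x_oo | x_fin] : {x = infty} + {x <> infty}.
  have := first_bits (svalP w); case fk: (bits (f infty) (sval w)) => /= gk.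
    exact: infty_dec f_inj fk.
  exact: infty_dec g_inj gk.
- by exists (inr w).
- have ex_k := Markov_finite MP x_fin.
  by exists (inl (xchoose ex_k)); apply/esym/bits_underline/xchooseP.
Qed.

(* [k n <> k infty], so a bit where they differ shows either [k n] or
   [k infty] to be finite. *)
Lemma restrict (k : Ninf -> Ninf) : injective k ->
  (forall n, bits (k infty) n -> exists m, bits finite_image m) ->
  forall a, {b | decode b = k (decode a)}.
Proof.
move=> k_inj kw [n|w]; last exact: encode.
have ex_j : exists j, bits (k (underline n)) j != bits (k infty) j.
  by apply: Markov_apart MP _ _ _ => /k_inj/underline_infty.
have := xchooseP ex_j; case knj: (bits (k (underline n)) (xchoose ex_j)) => /=.
  by exists (inl (xchoose ex_j)); apply/esym/bits_underline.
case kj: (bits (k infty) _) => // _; have ex_m := kw _ kj.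
exact: encode (exist _ (xchoose ex_m) (xchooseP ex_m)) _.
Qed.

Lemma decode_dec (x : Ninf) (a : code) : {x = decode a} + {x <> decode a}.
Proof.
case: a => [n|w].
  case xn: (bits x n); [left; exact: bits_underline | right => x_n].
  by rewrite x_n /= eqxx in xn.
(* Given [w], the point [x] has a code too, and codes have decidable equality. *)
by case: (encode w x) => b <-; case: (b =P inr w) => [->|bw];
  [left | right => /decode_inj].
Qed.

Section Extension.

Variables (H H' : code -> code).
Hypotheses (HK : cancel H H') (HK' : cancel H' H).

Lemma extend_subproof (x : Ninf) :
  at_most_one (fun k => decode_dec x (H' (inl k)) : bool).
Proof.
move=> i j; case: decode_dec => // xi _; case: decode_dec => // xj _.
by have [] := can_inj HK' (decode_inj (etrans (esym xi) xj)).
Qed.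

(** A general [x] comes without a code, but can be compared with any decoded point; hence the use of
    [H']. *)
Definition extend (x : Ninf) : Ninf := MkNinf (@extend_subproof x).

Lemma bits_extend x k : bits (extend x) k <-> x = decode (H' (inl k)).
Proof. by rewrite /=; case: decode_dec. Qed.

Lemma extend_decode a : extend (decode a) = decode (H a).
Proof.
apply: Ninf_eqP => k; split=> [/bits_extend/decode_inj-> | Hak].
  by rewrite HK' /= eqxx.
apply/bits_extend; rewrite -[a in LHS]HK; congr (decode (H' _)).
by apply: decode_inj; apply: bits_underline.
Qed.

Lemma extend_infty : finite_image = infty -> extend infty = infty.
Proof.
move=> w_oo; apply: Ninf_eqP => k; split=> // /bits_extend.
(* A finite point is not [infty], and an [inr] code would carry a [1] of [finite_image]. *)
case: (H' _) => [n /esym/underline_infty//|[j wj]].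
by have : bits infty j by rewrite -w_oo.
Qed.

End Extension.

Definition witness (x : Ninf) : Ninf :=
  first (fun k => bits x k || bits finite_image k).

Lemma witnessP x : (exists n, witness x = underline n) \/ witness x = infty ->
  (exists a, x = decode a) \/ x = infty /\ finite_image = infty.
Proof.
case=> [[n xw_n] | xw_oo]; [left | right].
  have: bits (witness x) n by rewrite xw_n /= eqxx.
  move/first_bits/orP=> [/bits_underline-> | wn]; first by exists (inl n).
  by have [a <-] := encode (exist _ n wn) x; exists a.
have xwF k : ~~ (bits x k || bits finite_image k) by rewrite (first_infty k xw_oo).
by split; apply: Ninf_eq => k; case/norP: (xwF k) => /negbTE ? /negbTE.
Qed.

Lemma not_not_witness (x : Ninf) : ~ ~ ((exists n, x = underline n) \/ x = infty).
Proof.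
move=> nx; apply: (nx); right; apply: Ninf_eq => k.
by apply/negbTE/negP => /bits_underline xk; apply: nx; left; exists k.
Qed.

Lemma extend_can (H H' : code -> code) (HK : cancel H H') (HK' : cancel H' H) :
  cancel (extend HK') (extend HK).
Proof.
(* Equality is stable, so [witness x] may be assumed finite or [infty]. *)
move=> x; apply: Ninf_eq_stable => nx.
apply: (@not_not_witness (witness x)) => /witnessP [[a xa] | [x_oo w_oo]]; apply: nx.
  by rewrite xa !extend_decode ?HK.
by rewrite x_oo !extend_infty.
Qed.

End Finite.

(** * The Myhill bijection of [Ninf] *)

Lemma iter_semiconj (A B : Type) (d : A -> B) (p q : A -> A) (p' q' : B -> B) :
  (forall a, d (p a) = p' (d a)) -> (forall a, d (q a) = q' (d a)) ->
  forall n a, d (iter n (p \o q) a) = iter n (p' \o q') (d a).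
Proof. by move=> dp dq n a; elim: n => //= n <-; rewrite dp dq. Qed.

Theorem theorem37 : Markov -> strong_Myhill O_LPO Ninf.
Proof.
move=> MP f g f_inj g_inj.
have fw k : bits (f infty) k -> exists j, bits (finite_image f g) j.
  by move=> fk; apply: (@first_ex _ k); rewrite fk.
have gw k : bits (g infty) k -> exists j, bits (finite_image f g) j.
  by move=> gk; apply: (@first_ex _ k); rewrite gk orbT.
pose F a := sval (restrict MP f_inj g_inj f_inj fw a).
pose G a := sval (restrict MP f_inj g_inj g_inj gw a).
have decF a : decode (F a) = f (decode a) := svalP (restrict _ _ _ _ _ a).
have decG a : decode (G a) = g (decode a) := svalP (restrict _ _ _ _ _ a).
have F_inj : injective F.
  by move=> a b Fab; apply/decode_inj/f_inj; rewrite -!decF Fab.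
have G_inj : injective G.
  by move=> a b Gab; apply/decode_inj/g_inj; rewrite -!decG Gab.
have [H [H' [HK HK' HC]]] := Myhill_countType F_inj G_inj.
exists (extend MP f_inj g_inj HK'); split.
  by exists (extend MP f_inj g_inj HK); apply: extend_can.
move=> x; exists (witness f g x) => /(witnessP MP f_inj g_inj) [[a ->] | [-> w_oo]].
  have [m Rm] := HC a; exists m; rewrite extend_decode //.
  (* [decode] intertwines [F], [G] with [f], [g], hence carries the chain relation over. *)
  case: m Rm => n /= /(congr1 (@decode f g)) ->.
    by rewrite decF (iter_semiconj decG decF).
  by rewrite decG (iter_semiconj decF decG).
(* Here [f infty = infty], so exponent [0] relates [infty] to itself. *)
exists (Posz 0); rewrite extend_infty //=.
apply: esym; apply: Ninf_eq => k; have := first_infty k w_oo.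
by case: (bits (f infty) k).
Qed.
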